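(* Let $\varrho=((\rho_t^x)_{t\in\mathbb{N}_0})_{x\in E}$ be a family of dynamic conditional risk mappings such that $(\rho^x)_{x\in E}$ is regular and each risk mapping $\rho^x$ is convex and continuous from below. Then $\varrho$ satisfies the one-step Markov property, namely $$\rho_t^x(f(X_{t+1}))=\rho^{X_t}(f(X_1))\quad\mathbb{P}^x\text{-a.s. for every }t\in\mathbb{N}_0,\ x\in E,\ f\in b\mathcal{E},$$ if and only if for all $x\in E$ and $f\in b\mathcal{E}$ we have $$\rho^x(f(X_1))=\sup_{q\in\mathcal{K}}\left(\int_E f(y)\,q(\mathrm{d}y\vert x)-\alpha^x(q(\cdot\vert x))\right)$$ and, $\mathbb{P}^x$-almost surely, $$\rho_t^x(f(X_{t+1}))=\sup_{q\in\mathcal{K}}\left(\int_E f(y)\,q(\mathrm{d}y\vert X_t)-\alpha^{X_t}(q(\cdot\vert X_t))\right),\qquad t=1,2,\ldots.$$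
   Context: Setting. $E$ is a Polish space with Borel $\sigma$-algebra $\mathcal{E}$; $\mathbb{N}_0=\{0,1,2,\ldots\}$; $\Omega=E^{\mathbb{N}_0}$; $X_t(\omega)=\omega(t)$ is the coordinate process; $\mathcal{F}_t=\sigma(X_s: s\le t)$ and $\mathcal{F}=\sigma(\bigcup_t\mathcal{F}_t)$. $X$ is a time-homogeneous Markov chain; $x\mapsto\mathbb{P}^x$ is a measurable map from $E$ to the probability measures on $(\Omega,\mathcal{F})$, where $\mathbb{P}^x$ is the law of the chain started at $x$ (so $\mathbb{P}^x(X_0=x)=1$); its transition kernel is $q^X(B\vert x)=\mathbb{P}^x(X_1\in B)$, $B\in\mathcal{E}$. $b\mathcal{G}$ denotes the bounded $\mathcal{G}$-measurable real functions; $\mathscr{P}(\mathcal{E})$ the probability measures on $(E,\mathcal{E})$. Risk mapping on $(\Omega,\mathcal{F},\mathbb{P}^x)$: a function $\rho^x:b\mathcal{F}\to\mathbb{R}$ with $\rho^x(0)=0$; $\rho^x(Z+c)=c+\rho^x(Z)$ for $Z\in b\mathcal{F}$, $c\in\mathbb{R}$; and $Z\le Z'$ $\mathbb{P}^x$-a.s. implies $\rho^x(Z)\le\rho^x(Z')$. It is convex if $\rho^x(\lambda Z+(1-\lambda)Z')\le\lambda\rho^x(Z)+(1-\lambda)\rho^x(Z')$ for $\lambda\in[0,1]$, and continuous from below if $\rho^x(Y_n)\to\rho^x(Y)$ for every increasing sequence $(Y_n)$ in $b\mathcal{F}$ converging $\mathbb{P}^x$-a.s. to $Y\in b\mathcal{F}$.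 Conditional risk mapping on $(\Omega,\mathcal{F},\mathbb{P}^x)$ with respect to $\mathcal{F}_t$: a function $\rho^x_t:b\mathcal{F}\to b\mathcal{F}_t$ with $\rho_t^x(0)=0$ $\mathbb{P}^x$-a.s.; $\rho_t^x(Z+Z')=Z'+\rho_t^x(Z)$ $\mathbb{P}^x$-a.s. for $Z\in b\mathcal{F}$, $Z'\in b\mathcal{F}_t$; and $Z\le Z'$ $\mathbb{P}^x$-a.s. implies $\rho_t^x(Z)\le\rho_t^x(Z')$ $\mathbb{P}^x$-a.s. Dynamic conditional risk mapping on $(\Omega,\mathcal{F},(\mathcal{F}_t),\mathbb{P}^x)$: a sequence $(\rho_t^x)_{t\in\mathbb{N}_0}$ where $\rho_0^x$ is a risk mapping and, for $t\ge1$, $\rho_t^x$ is a conditional risk mapping with respect to $\mathcal{F}_t$ (both on $(\Omega,\mathcal{F},\mathbb{P}^x)$). A family of dynamic conditional risk mappings consists of one such sequence for each $x\in E$. Write $\rho^x:=\rho_0^x$, and $\rho^{X_t}(Z)$ for the random variable $\omega\mapsto\rho^{X_t(\omega)}(Z)$. Regularity: a collection $(\rho^x)_{x\in E}$ of risk mappings is regular if for all $Z\in b\mathcal{F}$ the map $x\mapsto\rho^x(Z)$ is bounded and measurable. Define $\mathcal{R}(x,f):=\rho^x(f(X_1))$ for $x\in E$, $f\in b\mathcal{E}$, and the penalty functions $\alpha^x:\mathscr{P}(\mathcal{E})\to\mathbb{R}\cup\{+\infty\}$ by $\alpha^x(Q)=\sup_{g\in b\mathcal{E}}\left(\int_E g\,\mathrm{d}Q-\mathcal{R}(x,g)\right)$.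 $\mathcal{K}$ denotes the set of probability kernels $q$ from $E$ to $E$ (i.e. $q(\cdot\vert x)\in\mathscr{P}(\mathcal{E})$ for each $x$ and $x\mapsto q(B\vert x)$ is measurable for each $B\in\mathcal{E}$) such that $q(\cdot\vert x)$ is absolutely continuous with respect to $q^X(\cdot\vert x)$ for every $x\in E$. *)

(* Defs.v *)
From HB Require Import structures.
From mathcomp Require Import all_boot all_order all_algebra.
From mathcomp Require Import all_classical all_reals all_analysis.
From mathcomp Require Import measurable_realfun.

Set Implicit Arguments.
Unset Strict Implicit.
Unset Printing Implicit Defensive.

Import Order.TTheory GRing.Theory Num.Theory.
Import numFieldNormedType.Exports.

Local Open Scope classical_set_scope.
Local Open Scope ring_scope.

Record complete_metric_for (R : realType) (E : topologicalType)
    (dist : E -> E -> R) : Prop := {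
  cmf_eq0 : forall x y, dist x y = 0 <-> x = y;
  cmf_sym : forall x y, dist x y = dist y x;
  cmf_triangle : forall x y z, dist x z <= dist x y + dist y z;
  cmf_nbhs : forall (x : E) (A : set E), nbhs x A <->
    exists2 e : R, 0 < e & [set y | dist x y < e] `<=` A;
  cmf_complete : forall u : nat -> E,
    (forall e : R, 0 < e -> exists N : nat,
       forall m n, (N <= m)%N -> (N <= n)%N -> dist (u m) (u n) < e) ->
    exists l : E, u @ \oo --> l }.

Definition polish_space (R : realType) (E : topologicalType) : Prop :=
  (exists2 D : set E, countable D & dense D) /\
  (exists dist : E -> E -> R, complete_metric_for dist).

Definition borel (E : ptopologicalType) : measurableType (@open E).-sigma :=
  g_sigma_algebraType (@open E).

Section path_space.
Context {d : measure_display} (E : measurableType d).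

(* the preimages under X_0, ..., X_t, which generate F_t *)
Definition history_events (t : nat) : set (set (nat -> E)) :=
  \bigcup_(s in [set s | (s <= t)%N])
    preimage_set_system setT (fun w : nat -> E => w s) measurable.

(* (E^N, F_t) *)
Definition history (t : nat) : measurableType (history_events t).-sigma :=
  g_sigma_algebraType (history_events t).

Definition path_events : set (set (nat -> E)) :=
  \bigcup_t <<s history_events t >>.

(* (E^N, F) *)
Definition path_space : measurableType path_events.-sigma :=
  g_sigma_algebraType path_events.

Definition coord_at (t : nat) (w : path_space) : E := w t.

End path_space.
Arguments coord_at {d E}.

Definition bmeas {d : measure_display} (T : measurableType d) (R : realType) :
    set (T -> R) :=
  [set f : T -> R | measurable_fun setT f /\ bounded_fun f].
Arguments bmeas {d} T R.

Section markov_chain.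
Context {d : measure_display} (E : measurableType d) (R : realType).
Variable P : E -> probability (path_space E) R.

Definition transition (x : E) : set E -> \bar R :=
  pushforward (P x) (coord_at 1).

(* The last clause says that the conditional probability of
   [X_(t+1) \in B] given F_t is q^X(B | X_t), for every initial state. *)
Definition markov_chain : Prop :=
  measurable_fun setT (P : E -> pprobability (path_space E) R) /\
  (forall x, P x (coord_at 0 @^-1` [set x]) = 1%E) /\
  (forall x t (A : set (history E t)) (B : set E),
     measurable A -> measurable B ->
     (P x (A `&` coord_at t.+1 @^-1` B)
      = \int[P x]_(w in A) transition (coord_at t w) B)%E).

(* the set K; a probability kernel is given by its family of measures *)
Definition dominated_kernels : set (E -> probability E R) :=
  [set q : E -> probability E R |
     (forall B, measurable B -> measurable_fun [set: E] (fun x => q x B)) /\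
     (forall x, q x `<< transition x)].

End markov_chain.

(* A map defined on bounded measurable functions only is represented by a total
   one, whose values at other functions are left unconstrained and unused. *)
Section risk_mapping.
Context {d : measure_display} (T : measurableType d) (R : realType).
Variable mu : probability T R.
Implicit Types Z Y : T -> R.

Record risk_mapping (rho : (T -> R) -> R) : Prop := {
  risk_0 : rho (cst 0) = 0;
  risk_translation : forall Z (c : R), bmeas T R Z ->
    rho (fun w => Z w + c) = c + rho Z;
  risk_monotone : forall Z Z', bmeas T R Z -> bmeas T R Z' ->
    {ae mu, forall w, Z w <= Z' w} -> rho Z <= rho Z' }.

Definition risk_convex (rho : (T -> R) -> R) : Prop :=
  forall (l : R) Z Z', 0 <= l <= 1 -> bmeas T R Z -> bmeas T R Z' ->
    rho (fun w => l * Z w + (1 - l) * Z' w) <= l * rho Z + (1 - l) * rho Z'.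

Definition risk_continuous_from_below (rho : (T -> R) -> R) : Prop :=
  forall (Y_ : nat -> T -> R) Y,
    (forall n, bmeas T R (Y_ n)) -> bmeas T R Y ->
    (forall n w, Y_ n w <= Y_ n.+1 w) ->
    {ae mu, forall w, Y_ n w @[n --> \oo] --> Y w} ->
    rho (Y_ n) @[n --> \oo] --> rho Y.

End risk_mapping.

Section dynamic_risk_mapping.
Context {d : measure_display} (E : measurableType d) (R : realType).
Local Notation Omega := (path_space E).
Implicit Types (mu : probability Omega R) (Z : Omega -> R).

Record cond_risk_mapping mu (t : nat)
    (rho : (Omega -> R) -> Omega -> R) : Prop := {
  crisk_closed : forall Z, bmeas Omega R Z -> bmeas (history E t) R (rho Z);
  crisk_0 : {ae mu, forall w, rho (cst 0) w = 0};
  crisk_translation : forall Z Z',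
    bmeas Omega R Z -> bmeas (history E t) R Z' ->
    {ae mu, forall w, rho (fun w' => Z w' + Z' w') w = Z' w + rho Z w};
  crisk_monotone : forall Z Z', bmeas Omega R Z -> bmeas Omega R Z' ->
    {ae mu, forall w, Z w <= Z' w} -> {ae mu, forall w, rho Z w <= rho Z' w} }.

(* [risk0] is real-valued; [riskS t] is the conditional mapping at time t+1 *)
Record risk_sequence := RiskSequence {
  risk0 : (Omega -> R) -> R;
  riskS : nat -> (Omega -> R) -> Omega -> R }.

(* the mapping at time t, with the real value at time 0 read as a constant *)
Definition risk_at (rho : risk_sequence) (t : nat) Z : Omega -> R :=
  if t is s.+1 then riskS rho s Z else cst (risk0 rho Z).

Definition dynamic_risk_mapping mu (rho : risk_sequence) : Prop :=
  risk_mapping mu (risk0 rho) /\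
  forall t, (0 < t)%N -> cond_risk_mapping mu t (risk_at rho t).

Definition regular_risk (rho : E -> (Omega -> R) -> R) : Prop :=
  forall Z, bmeas Omega R Z -> bmeas E R (fun x => rho x Z).

Variable rho : E -> risk_sequence.

Definition one_step_markov (P : E -> probability Omega R) : Prop :=
  forall t x (f : E -> R), bmeas E R f ->
    {ae P x, forall w, risk_at (rho x) t (f \o coord_at t.+1) w
                       = risk0 (rho (coord_at t w)) (f \o coord_at 1)}.

Definition one_step_risk (x : E) (f : E -> R) : R :=
  risk0 (rho x) (f \o coord_at 1).

Local Open Scope ereal_scope.

Definition penalty (x : E) (Q : probability E R) : \bar R :=
  ereal_sup [set \int[Q]_y (g y)%:E - (one_step_risk x g)%:E
            | g in bmeas E R].

End dynamic_risk_mapping.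

(* Main.v *)
From HB Require Import structures.
Require Import Defs.
From mathcomp Require Import all_boot all_order all_algebra.
From mathcomp Require Import all_classical all_reals all_analysis.
From mathcomp Require Import measurable_realfun.
From mathcomp Require Import ring lra.

Set Implicit Arguments.
Unset Strict Implicit.
Unset Printing Implicit Defensive.

Import Order.TTheory GRing.Theory Num.Theory.
Import numFieldNormedType.Exports.

Local Open Scope classical_set_scope.
Local Open Scope ring_scope.

(* Since [rho_t^x] is compared with the static mapping at [X_t], the equivalence
   amounts to the dual representation of [r := R(x, .)] for each [x]; a kernel of
   K may be modified at the single point [x], so there the supremum runs over all
   [Q] absolutely continuous with respect to the law [mu] of [X_1].

   Weak duality is immediate.  Conversely, given [f] and [e > 0], let [C] be the
   convex set of bounded [k] with [r(f - k) <= r f - e], and [C+] its nonnegative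
   part.  Any [Q << mu] with [\int k dQ >= 0] on [C] is an [e]-subgradient at [f]:
   take [k := f - g + (r g - r f + e)].  Such a [Q] is found in two steps.
   - By continuity from below, [C+] is closed under bounded a.e. convergence, and
     no [k] in [C+] is a.e. at most [e/2].  As in the Krein-Smulian theorem, a
     weight [\sum v_n], with [v_n] of mass at most [2 / M_n] and [M_n] geometric,
     is built inductively so that the integral of [k] against it exceeds 1 for
     all [k] in [C+]; positivity makes the contributions add up.
   - Hence [C+] stays away from 0 in [L^2] of this weight, and so does [C]; the
     element of minimal norm in its closure is the density of [Q]. *)

(** * Calculus of bounded measurable functions *)

Section bounded_measurable.
Context d (T : measurableType d) (R : realType).
Implicit Types f g : T -> R.
Local Notation bm := (bmeas T R).

(** [bounded_fun] speaks of all large enough bounds; a single explicit bound is easier to carry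
    through sums and products. *)
Lemma bmeasP f :
  bm f <-> measurable_fun setT f /\ exists M : R, forall x, `|f x| <= M.
Proof.
split=> -[mf bf]; split=> //.
  case: bf => M [_ bM]; exists (M + 1) => x.
  by apply: (bM (M + 1)) => //; rewrite ltrDl.
case: bf => M bM; exists M; split; first exact: num_real.
by move=> N MN x _ /=; rewrite (le_trans (bM x))// ltW.
Qed.

Lemma bmeas_cst (c : R) : bm (fun=> c).
Proof. by apply/bmeasP; split=> //; exists `|c|. Qed.

Lemma bmeasD f g : bm f -> bm g -> bm (fun x => f x + g x).
Proof.
move=> /bmeasP[mf [M fM]] /bmeasP[mg [N gN]]; apply/bmeasP; split.
  exact: measurable_funD.
by exists (M + N) => x; rewrite (le_trans (ler_normD _ _))// lerD.
Qed.

Lemma bmeasM f g : bm f -> bm g -> bm (fun x => f x * g x).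
Proof.
move=> /bmeasP[mf [M fM]] /bmeasP[mg [N gN]]; apply/bmeasP; split.
  exact: measurable_funM.
by exists (M * N) => x; rewrite normrM ler_pM.
Qed.

Lemma bmeasZ (c : R) f : bm f -> bm (fun x => c * f x).
Proof. by move=> bf; apply: bmeasM => //; exact: bmeas_cst. Qed.

Lemma bmeasB f g : bm f -> bm g -> bm (fun x => f x - g x).
Proof.
move=> bf bg; rewrite (_ : (fun x => _) = (fun x => f x + -1 * g x)); last first.
  by apply/funext => x; rewrite mulN1r.
by apply: bmeasD => //; exact: bmeasZ.
Qed.

Lemma bmeasX f n : bm f -> bm (fun x => f x ^+ n).
Proof.
move=> bf; elim: n => [|n IH]; first exact: bmeas_cst.
by under eq_fun do rewrite exprS; exact: bmeasM.
Qed.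

Lemma bmeas_max f g : bm f -> bm g -> bm (fun x => Num.max (f x) (g x)).
Proof.
move=> /bmeasP[mf [M fM]] /bmeasP[mg [N gN]]; apply/bmeasP; split.
  exact: measurable_maxr.
by exists (Num.max M N) => x; rewrite le_max; case: (leP (f x) (g x)) => _;
  rewrite ?fM ?gN ?orbT.
Qed.

Lemma bmeas_min f g : bm f -> bm g -> bm (fun x => Num.min (f x) (g x)).
Proof.
move=> /bmeasP[mf [M fM]] /bmeasP[mg [N gN]]; apply/bmeasP; split.
  exact: measurable_minr.
by exists (Num.max M N) => x; rewrite le_max; case: (leP (f x) (g x)) => _;
  rewrite ?fM ?gN ?orbT.
Qed.

Lemma bmeas_normr f : bm f -> bm (fun x => `|f x|).
Proof.
move=> /bmeasP[mf [M fM]]; apply/bmeasP; split.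
  exact: measurableT_comp.
by exists M => x; rewrite normr_id.
Qed.

Lemma bmeas_integrable (mu : {finite_measure set T -> \bar R}) f :
  bm f -> mu.-integrable setT (EFin \o f).
Proof.
move=> [mf bf]; apply: measurable_bounded_integrable => //.
by rewrite -ge0_fin_numE// fin_num_measure.
Qed.

Lemma EFin_Rintegral (mu : {measure set T -> \bar R}) f :
  mu.-integrable setT (EFin \o f) ->
  (\int[mu]_x f x)%:E = (\int[mu]_x (f x)%:E)%E.
Proof. by move=> fi; rewrite fineK// integrable_fin_num. Qed.

End bounded_measurable.

(** * Dominated limits, and probabilities given by a density *)

Lemma Rintegral_dominated_cvg d (T : measurableType d) (R : realType)
    (mu : {measure set T -> \bar R}) (u : nat -> T -> R) (l : T -> R)
    (G : T -> \bar R) :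
    (forall n, measurable_fun setT (u n)) -> measurable_fun setT l ->
    {ae mu, forall x, u n x @[n --> \oo] --> l x} ->
    mu.-integrable setT G -> (forall n x, (`|u n x|%:E <= G x)%E) ->
  mu.-integrable setT (EFin \o l) /\
  \int[mu]_x u n x @[n --> \oo] --> \int[mu]_x l x.
Proof.
move=> mu_ ml ul iG uG.
have [] := @dominated_convergence _ _ _ mu setT measurableT
  (fun n => EFin \o u n) (EFin \o l) G.
- by move=> n; exact/measurable_EFinP.
- exact/measurable_EFinP.
- by apply: filterS ul => x ulx _; apply: cvg_EFin => //; exact: nearW.
- exact: iG.
- by apply: aeW => x n _; exact: uG.
move=> il _ cint; split=> //; apply: fine_cvg.
by rewrite EFin_Rintegral.
Qed.

Lemma Rintegral_bounded_cvg d (T : measurableType d) (R : realType)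
    (mu : {finite_measure set T -> \bar R}) (u : nat -> T -> R) (l : T -> R)
    (M : R) :
    (forall n, measurable_fun setT (u n)) -> measurable_fun setT l ->
    {ae mu, forall x, u n x @[n --> \oo] --> l x} ->
    (forall n x, `|u n x| <= M) ->
  \int[mu]_x u n x @[n --> \oo] --> \int[mu]_x l x.
Proof.
move=> mu_ ml ul uM.
have iM : mu.-integrable setT (EFin \o cst M).
  exact: bmeas_integrable (bmeas_cst _ _).
by apply: (Rintegral_dominated_cvg mu_ ml ul iM _).2 => n x; rewrite lee_fin.
Qed.

Lemma ae_limit d (T : measurableType d) (R : realType)
    (mu : {measure set T -> \bar R}) (u : nat -> T -> R) :
    (forall n, measurable_fun setT (u n)) ->
    {ae mu, forall x, cvgn (u ^~ x)} ->
  exists2 l : T -> R, measurable_fun setT l &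
    {ae mu, forall x, u n x @[n --> \oo] --> l x}.
Proof.
(* The upper limit is measurable whether or not [u] converges, and [fine] returns the limit wherever
   it does. *)
move=> mu_ cu; exists (fun x => fine (limn_esup (fun n => (u n x)%:E))).
  apply: measurableT_comp => //.
  by apply: measurable_fun_limn_esup => n; exact/measurable_EFinP.
apply: filterS cu => x /cvg_ex[l ul].
have ulE : (u n x)%:E @[n --> \oo] --> l%:E.
  by apply: cvg_EFin => //; exact: nearW.
rewrite is_cvg_limn_esupE; last by apply/cvg_ex; exists l%:E.
by rewrite (cvg_lim _ ulE).
Qed.

(** [h] is a version of the Radon-Nikodym derivative of [A |-> \int_A h], so the change of variables
    formula for that derivative carries over to [h]. *)
Lemma exists_density d (T : measurableType d) (R : realType)
    (mu : {finite_measure set T -> \bar R}) (h : T -> \bar R) :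
    measurable_fun setT h -> (forall x, 0 <= h x)%E ->
    (\int[mu]_x h x = 1)%E ->
  exists2 nu : probability T R, nu `<< mu &
    forall g : T -> R, measurable_fun setT g -> (forall x, 0 <= g x) ->
      (\int[nu]_x (g x)%:E = \int[mu]_x ((g x)%:E * h x))%E.
Proof.
move=> mh h0 h1; pose nu A := (\int[mu]_(x in A) h x)%E.
have nu0 : nu set0 = 0%E by rewrite /nu integral_set0.
have nu_ge0 A : (0 <= nu A)%E by exact: integral_ge0.
have nu_additive : semi_sigma_additive nu.
  exact: semi_sigma_additive_nng_induced.
pose nuM := isMeasure.Build _ _ _ nu nu0 nu_ge0 nu_additive.
pose nuT : {measure set T -> \bar R} := HB.pack nu nuM.
pose nuP := @Measure_isProbability.Build _ _ _ nuT h1.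
pose P : probability T R := HB.pack nu nuM nuP.
have Pmu : P `<< mu.
  apply/null_content_dominatesP => A mA muA; rewrite /P/= /nu.
  by apply: null_set_integral => //; exact: measurable_funTS.
exists P => // g mg g0.
have mgE : measurable_fun setT (EFin \o g) by exact/measurable_EFinP.
rewrite -(Radon_Nikodym_SigmaFinite.change_of_variables Pmu)//.
have ih : mu.-integrable setT h.
  apply/integrableP; split=> //.
  by under eq_integral do rewrite gee0_abs//; rewrite h1 ltry.
have RNh : ae_eq mu setT (Radon_Nikodym_SigmaFinite.f P mu) h.
  apply: integral_ae_eq => //.
    exact: Radon_Nikodym_SigmaFinite.f_integrable.
  by move=> A _ mA; rewrite -Radon_Nikodym_SigmaFinite.f_integral.
apply: ae_eq_integral => //.
- apply: emeasurable_funM => //; apply: (measurable_int mu).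
  exact: Radon_Nikodym_SigmaFinite.f_integrable.
- exact: emeasurable_funM.
- by apply: filterS RNh => x /= + _ => ->.
Qed.

(** * Minimising sequences in L^2 and their a.e. limits *)

(** The parallelogram law, arranged around the midpoint because midpoints stay in a convex set. *)
Lemma Rintegral_midpoint_sqr d (T : measurableType d) (R : realType)
    (mu : {finite_measure set T -> \bar R}) (f g : T -> R) :
    bmeas T R f -> bmeas T R g ->
  \int[mu]_x (f x - g x) ^+ 2 =
  2 * \int[mu]_x f x ^+ 2 + 2 * \int[mu]_x g x ^+ 2
  - 4 * \int[mu]_x ((f x + g x) / 2) ^+ 2.
Proof.
move=> bf bg.
have bm : bmeas T R (fun x => (f x + g x) / 2).
  by apply: bmeasM; [exact: bmeasD | exact: bmeas_cst].
have i k : bmeas T R k -> mu.-integrable setT (EFin \o (fun x => k x ^+ 2)).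
  by move=> bk; apply/bmeas_integrable/bmeasX.
have iZ c k : bmeas T R k ->
    mu.-integrable setT (EFin \o (fun x => c * k x ^+ 2)).
  by move=> bk; apply/bmeas_integrable/bmeasZ/bmeasX.
rewrite -!RintegralZl//; try exact: i.
rewrite -RintegralD//; try exact: iZ.
rewrite -RintegralB//; first last.
- exact: iZ.
- by apply/bmeas_integrable/bmeasD; apply/bmeasZ/bmeasX.
- by apply: eq_Rintegral => x _; lra.
Qed.

(** Sum and integral commute for nonnegative terms, so the integral is at most the geometric sum
    [2 c]. *)
Lemma integrable_geometric_series d (T : measurableType d) (R : realType)
    (mu : {finite_measure set T -> \bar R}) (v : nat -> T -> R) (c : R) :
    (forall n, bmeas T R (v n)) -> (forall n x, 0 <= v n x) ->
    (forall n, \int[mu]_x v n x <= c * 2^-1 ^+ n) ->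
  mu.-integrable setT (fun x => \sum_(n <oo) (v n x)%:E)%E.
Proof.
move=> bv v0 cv.
have mv n : measurable_fun setT (EFin \o v n).
  by apply/measurable_EFinP; case: (bv n).
apply/integrableP; split.
  by apply: (@ge0_emeasurable_sum _ _ _ setT (fun n => EFin \o v n) xpredT)
    => // n x _ _; rewrite lee_fin.
under eq_integral.
  move=> x _; rewrite gee0_abs; last first.
    by apply: nneseries_ge0 => *; rewrite lee_fin.
  over.
rewrite integral_nneseries//; last by move=> n x _; rewrite lee_fin.
have c0 : 0 <= c.
  by have := cv 0%N; rewrite expr0 mulr1; apply: le_trans; exact: Rintegral_ge0.
apply: (@le_lt_trans _ _ (\sum_(n <oo) (geometric c 2^-1 n)%:E)%E).
  apply: lee_nneseries => n *; first by apply: integral_ge0 => x _; rewrite lee_fin.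
  by rewrite -EFin_Rintegral ?lee_fin ?cv//; exact: bmeas_integrable.
apply: (@le_lt_trans _ _ (c / (1 - 2^-1))%:E); last exact: ltry.
apply: lime_le.
  apply: is_cvg_ereal_nneg_natsum_cond => n _ _.
  by rewrite lee_fin mulr_ge0// exprn_ge0.
apply: nearW => n; rewrite sumEFin lee_fin.
by apply: (geometric_le_lim n c0); rewrite ?invr_gt0// ger0_norm ?invf_lt1 ?ltr1n.
Qed.

(** The series of absolute increments is integrable, hence finite a.e., and telescoping gives
    convergence; adding [|u 0|] to it bounds all [u n] at once. *)
Lemma fast_cauchy_ae_cvg d (T : measurableType d) (R : realType)
    (mu : {finite_measure set T -> \bar R}) (u : nat -> T -> R) (c : R) :
    (forall n, bmeas T R (u n)) ->
    (forall n, \int[mu]_x `|u n.+1 x - u n x| <= c * 2^-1 ^+ n) ->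
  {ae mu, forall x, cvgn (u ^~ x)} /\
  exists2 G : T -> \bar R, mu.-integrable setT G &
    forall n x, (`|u n x|%:E <= G x)%E.
Proof.
move=> bu cu; pose v n x := `|u n.+1 x - u n x|.
have bv n : bmeas T R (v n) by apply/bmeas_normr/bmeasB.
pose H x := (\sum_(n <oo) (v n x)%:E)%E.
have H0 x : (0 <= H x)%E by apply: nneseries_ge0 => *; rewrite lee_fin /v.
have iH : mu.-integrable setT H.
  by apply: (integrable_geometric_series bv _ cu) => n x; rewrite /v.
have telesc n x : u n x = u 0%N x + \sum_(0 <= i < n) (u i.+1 x - u i x).
  by rewrite telescope_sumr// addrC subrK.
split.
  have := integrable_ae measurableT iH; apply: filterS => x /(_ I) Hx.
  have cs : cvgn (series (fun n => u n.+1 x - u n x)).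
    apply: normed_cvg.
    apply: nondecreasing_is_cvgn.
      by apply: nondecreasing_series => n _ _; exact: normr_ge0.
    exists (fine (H x)) => _ [n _ <-]; rewrite -lee_fin fineK// /series/= -sumEFin.
    by apply: nneseries_lim_ge => *; rewrite lee_fin.
  rewrite (_ : u ^~ x = cst (u 0%N x) \+ series (fun n => u n.+1 x - u n x)).
    by apply: (is_cvgD _ cs); apply: is_cvg_cst.
  by apply/funext => n /=; exact: telesc.
exists (fun x => `|u 0%N x|%:E + H x)%E.
  apply: integrableD => //; apply: bmeas_integrable; exact: bmeas_normr.
move=> n x; apply: (@le_trans _ _ (`|u 0%N x| + \sum_(0 <= i < n) v i x)%:E).
  rewrite lee_fin telesc (le_trans (ler_normD _ _))// lerD2l.
  exact: ler_norm_sum.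
rewrite EFinD leeD2l// -sumEFin.
by apply: nneseries_lim_ge => *; rewrite lee_fin /v.
Qed.

(* Stands in for weak compactness: the [u n] have nearly minimal L^2 norm in [S m]
   for suitable [m >= n]. *)
Lemma nested_convex_selection d (T : measurableType d) (R : realType)
    (mu : {finite_measure set T -> \bar R}) (S : nat -> set (T -> R)) (B : R) :
    (forall n, S n.+1 `<=` S n) -> (forall n, S n `<=` bmeas T R) ->
    (forall n f g, S n f -> S n g -> S n (fun x => (f x + g x) / 2)) ->
    (forall n, exists2 f, S n f & \int[mu]_x f x ^+ 2 <= B) ->
  exists u : nat -> T -> R, [/\ forall n, S n (u n),
    forall f, (forall n, S n f) ->
      forall n, \int[mu]_x u n x ^+ 2 <= \int[mu]_x f x ^+ 2 + 4^-1 ^+ n,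
    {ae mu, forall x, cvgn (u ^~ x)} &
    exists2 G : T -> \bar R, mu.-integrable setT G &
      forall n x, (`|u n x|%:E <= G x)%E].
Proof.
move=> decS bS midS exS; pose N f := \int[mu]_x f x ^+ 2.
have subS m n : (m <= n)%N -> S n `<=` S m.
  elim: n => [|n IH]; first by rewrite leqn0 => /eqP ->.
  by rewrite leq_eqVlt => /orP[/eqP -> //|/IH Sm f /decS/Sm].
(* The supremum of [lb] is the limit of the infima of [N] over the sets [S n]. *)
pose lb : set R := [set a | exists n, forall f, S n f -> a <= N f].
have lbB : ubound lb B.
  by move=> a [n an]; have [f Sf fB] := exS n; rewrite (le_trans _ fB)// an.
have lb_sup : has_sup lb.
  split; last by exists B.
  exists 0; exists 0%N => f _; apply: Rintegral_ge0 => x _; exact: sqr_ge0.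
pose e := sup lb.
have q0 n : 0 < 4^-1 ^+ n :> R by rewrite exprn_gt0.
(* The index [p.1] is so large that [N] nearly exceeds [e] on all of [S p.1], while [p.2] nearly
   attains [e]. *)
have pick n : exists p : nat * (T -> R), [/\ (n <= p.1)%N, S p.1 p.2,
    N p.2 <= e + 4^-1 ^+ n & forall f, S p.1 f -> e - 4^-1 ^+ n <= N f].
  have [a [m am] ea] := sup_adherent (q0 n) lb_sup.
  have Sm f : S (maxn n m) f -> e - 4^-1 ^+ n <= N f.
    by move=> /(subS _ _ (leq_maxr n m)) /am; apply/le_trans/ltW.
  have : ~ lb (e + 4^-1 ^+ n).
    by move=> /(ub_le_sup lb_sup.2); rewrite leNgt ltrDl q0.
  move=> /forallNP/(_ (maxn n m))/existsNP[f /not_implyP[Sf /negP]].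
  rewrite -ltNge => Nf; exists (maxn n m, f); split=> //=.
    exact: leq_maxl.
  exact: ltW.
have [p pP] := choice pick.
(* Near-minimal norms together with midpoint convexity make [u] Cauchy in L^2. *)
pose u n := (p n).2; exists u.
have uS n : S n (u n) by have [/subS le_np /le_np] := pP n.
have bu n : bmeas T R (u n) by exact: bS (uS n).
have cauchy n : N (fun x => u n.+1 x - u n x) <= 8 * 4^-1 ^+ n.
  have [_ Su Nu eN] := pP n. have [_ Su' Nu' eN'] := pP n.+1. 
  have q4 : 4^-1 ^+ n = 4 * 4^-1 ^+ n.+1 :> R.
    by rewrite exprS mulrA divff ?mul1r ?pnatr_eq0.
  have q4' := q0 n.+1.
  (* The midpoint lies in the set with the smaller of the two indices, whose lower bound then
     applies. *)
  have mid : e - 4^-1 ^+ n <= N (fun x => (u n.+1 x + u n x) / 2).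
    have [le_p|/ltnW le_p] := leqP (p n).1 (p n.+1).1.
      by apply: eN; apply: midS => //; exact: subS Su'.
    apply: (@le_trans _ _ (e - 4^-1 ^+ n.+1)); first by lra.
    by apply: eN'; apply: midS => //; exact: subS Su.
  rewrite /N Rintegral_midpoint_sqr// -/(N _) -/(N _) -/(N _).
  by move: mid Nu Nu'; rewrite -/(u n) -/(u n.+1); lra.
have /(fast_cauchy_ae_cvg bu)[ucvg [G iG uG]] :
    forall n, \int[mu]_x `|u n.+1 x - u n x| <=
      ((8 + fine (mu setT)) / 2) * 2^-1 ^+ n.
  move=> n; pose h x := u n.+1 x - u n x.
  have bh : bmeas T R h by exact: bmeasB.
  (* The inequality [|h| <= 2^n h^2 / 2 + 2^-n / 2] trades the bound of order [4^-n] on the squared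
     norm for one of order [2^-n] in L^1. *)
  apply: (@le_trans _ _
    (\int[mu]_x (2 ^+ n / 2 * h x ^+ 2 + 2^-1 ^+ n / 2))).
    apply: le_Rintegral => //.
    - exact/bmeas_integrable/bmeas_normr.
    - apply/bmeas_integrable/bmeasD; last exact: bmeas_cst.
      exact/bmeasZ/bmeasX.
    - move=> x _; rewrite -/(h x) -[h x ^+ 2]real_normK ?num_real//.
      have t0 : 0 < 2 ^+ n :> R by rewrite exprn_gt0.
      have -> : 2 ^+ n / 2 * `|h x| ^+ 2 + 2^-1 ^+ n / 2 =
          `|h x| + (2 ^+ n * `|h x| - 1) ^+ 2 / 2 * 2^-1 ^+ n.
        by rewrite exprVn; field; rewrite lt0r_neq0.
      by rewrite lerDl mulr_ge0 ?exprn_ge0 ?invr_ge0// divr_ge0// sqr_ge0.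
  rewrite RintegralD//; last first.
  - exact/bmeas_integrable/bmeas_cst.
  - exact/bmeas_integrable/bmeasZ/bmeasX.
  rewrite RintegralZl//; last exact/bmeas_integrable/bmeasX.
  rewrite Rintegral_cst// -/(N h).
  have : 2 ^+ n / 2 * N h <= 2 ^+ n / 2 * (8 * 4^-1 ^+ n).
    by rewrite ler_wpM2l ?cauchy// divr_ge0// exprn_ge0.
  have -> : 2 ^+ n / 2 * (8 * 4^-1 ^+ n) = 8 / 2 * 2^-1 ^+ n :> R.
    rewrite (_ : 4^-1 = 2^-1 * 2^-1); last by rewrite -invfM -natrM.
    rewrite exprMn_comm; last exact: mulrC.
    have : 2 ^+ n * 2^-1 ^+ n = 1 :> R by rewrite -exprMn divff// expr1n.
    set a := 2 ^+ n; set b := 2^-1 ^+ n => ab.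
    transitivity (4 * (a * b) * b); first by field.
    by rewrite ab; field.
  by lra.
split=> //; last by exists G.
move=> f Sf n; have [_ _ Nu _] := pP n.
rewrite (le_trans Nu)// lerD2r; apply: ge_sup; first exact: lb_sup.1.
by move=> a [m am]; exact: am.
Qed.

(** * Variational separation for bounded convex sets *)

(** The positive part is convex, and squaring is increasing and convex on nonnegative reals. *)
Lemma sqr_pos_part_midpoint (R : realFieldType) (a b : R) :
  Num.max ((a + b) / 2) 0 ^+ 2 <= (Num.max a 0 ^+ 2 + Num.max b 0 ^+ 2) / 2.
Proof.
have [ap bp] : a <= Num.max a 0 /\ b <= Num.max b 0 by rewrite !le_max !lexx.
have [p0 q0] : 0 <= Num.max a 0 /\ 0 <= Num.max b 0 by rewrite !le_max !lexx !orbT.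
move: (Num.max a 0) (Num.max b 0) ap bp p0 q0 => p q ap bq p0 q0.
have : Num.max ((a + b) / 2) 0 <= (p + q) / 2 by rewrite ge_max; lra.
have : 0 <= Num.max ((a + b) / 2) 0 by rewrite le_max lexx orbT.
move: (Num.max _ _) => m m0 mpq.
have : m ^+ 2 <= ((p + q) / 2) ^+ 2 by rewrite lerXn2r// nnegrE; lra.
by have := sqr_ge0 (p - q); lra.
Qed.

(** The squared positive part has the 2-Lipschitz derivative [2 s^+]; this is the resulting
    quadratic upper bound. *)
Lemma sqr_pos_part_smooth (R : realFieldType) (s h : R) :
  Num.max (s + h) 0 ^+ 2 <= Num.max s 0 ^+ 2 + 2 * (Num.max s 0 * h) + h ^+ 2.
Proof.
case: (lerP s 0) => s0; case: (lerP (s + h) 0) => sh0.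
- by have := sqr_ge0 h; rewrite expr0n /=; lra.
- have : 0 <= - s * (s + h + h) by apply: mulr_ge0; lra.
  by rewrite expr0n /=; lra.
- by have := sqr_ge0 (s + h); rewrite expr0n /=; lra.
- by lra.
Qed.

(** If [a < 0], the choice [t = - a / (b - a)] gives [2 t a + t^2 b = t a + t^2 a < 0]. *)
Lemma first_order_ge0 (R : realFieldType) (a b : R) : 0 <= b ->
  (forall t, 0 < t -> t <= 1 -> 0 <= 2 * t * a + t ^+ 2 * b) -> 0 <= a.
Proof.
move=> b0 ab; rewrite leNgt; apply/negP => a0.
have den : 0 < b - a by lra.
have t0 : 0 < - a / (b - a) by rewrite divr_gt0// oppr_gt0.
have t1 : - a / (b - a) <= 1 by rewrite ler_pdivrMr//; lra.
have tE : - a / (b - a) * (b - a) = - a by rewrite divfK// gt_eqF.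
have := ab _ t0 t1; move: t0 tE; set t := _ / _ => t0 tE.
have -> : t ^+ 2 * b = t * (t * (b - a)) + t * (t * a) by ring.
have ta : t * a < 0 by rewrite pmulr_rlt0.
have tta : t * (t * a) < 0 by rewrite pmulr_rlt0.
by rewrite tE; nra.
Qed.

Definition convex_functions (T : Type) (R : realType) (S : set (T -> R)) :=
  forall f g t, S f -> S g -> 0 <= t <= 1 ->
    S (fun x => t * f x + (1 - t) * g x).

Lemma convex_functions_midpoint (T : Type) (R : realType) (S : set (T -> R))
    (f g : T -> R) :
  convex_functions S -> S f -> S g -> S (fun x => (f x + g x) / 2).
Proof.
move=> cS Sf Sg.
rewrite (_ : (fun x => _) = (fun x => 2^-1 * f x + (1 - 2^-1) * g x)).
  by apply: cS => //; apply/andP; split; lra.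
by apply/funext => x; lra.
Qed.

(* The minimiser [k'] of [J k := \int ((k - c)^+)^2] over [S] exists because
   sublevel sets of [J] are convex and bounded in L^2; the first-order condition at
   [k'] says that the normalised [(k' - c)^+] separates. *)
Lemma bounded_convex_separation d (T : measurableType d) (R : realType)
    (mu : {finite_measure set T -> \bar R}) (S : set (T -> R)) (c M : R) :
    0 <= c -> 0 <= M ->
    (forall k, S k -> bmeas T R k /\ forall x, 0 <= k x <= M) ->
    convex_functions S ->
    (forall (u : nat -> T -> R) (k : T -> R), (forall n, S (u n)) ->
       measurable_fun setT k -> (forall x, 0 <= k x <= M) ->
       {ae mu, forall x, u n x @[n --> \oo] --> k x} -> S k) ->
    (forall k, S k -> ~ {ae mu, forall x, k x <= c}) ->
  exists v : T -> R, [/\ bmeas T R v, forall x, 0 <= v x,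
    \int[mu]_x v x <= 1 & forall k, S k -> c <= \int[mu]_x (v x * k x)].
Proof.
move=> c0 M0 bS cS clS Sc.
have [[k0 Sk0]|S0] := pselect (exists k, S k); last first.
  exists (fun=> 0); split=> //; first exact: bmeas_cst.
    by rewrite Rintegral_cst// mul0r.
  by move=> k Sk; exfalso; apply: S0; exists k.
pose phi (k : T -> R) x := Num.max (k x - c) 0.
have bphi k : S k -> bmeas T R (phi k).
  move=> /bS[bk _]; apply: bmeas_max; last exact: bmeas_cst.
  by apply: bmeasB => //; exact: bmeas_cst.
pose J k := \int[mu]_x phi k x ^+ 2.
have iphi k : S k -> mu.-integrable setT (EFin \o (fun x => phi k x ^+ 2)).
  by move=> /bphi bk; exact/bmeas_integrable/bmeasX.
pose j := inf (J @` S).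
have J_inf : has_inf (J @` S).
  split; first by exists (J k0), k0.
  by exists 0 => _ [k _ <-]; apply: Rintegral_ge0 => x _; exact: sqr_ge0.
have jJ k : S k -> j <= J k.
  by move=> Sk; apply: ge_inf; [exact: J_inf.2 | exists k].
(* The slack keeps each sublevel set nonempty and vanishes in the limit, so that a limit of the
   selected functions minimises [J]. *)
pose Sn (n : nat) : set (T -> R) := [set k | S k /\ J k <= j + n.+1%:R^-1].
have [u [uS _ ucvg _]] : exists u : nat -> T -> R, [/\ forall n, Sn n (u n),
    forall f, (forall n, Sn n f) ->
      forall n, \int[mu]_x u n x ^+ 2 <= \int[mu]_x f x ^+ 2 + 4^-1 ^+ n,
    {ae mu, forall x, cvgn (u ^~ x)} &
    exists2 G : T -> \bar R, mu.-integrable setT G &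
      forall n x, (`|u n x|%:E <= G x)%E].
  apply: (@nested_convex_selection _ _ _ _ _ (M ^+ 2 * fine (mu setT))).
  - move=> n k [Sk Jk]; split=> //; rewrite (le_trans Jk)// lerD2l.
    by rewrite lef_pV2 ?posrE// ler_nat.
  - by move=> n k [/bS[]].
  - move=> n f g [Sf Jf] [Sg Jg]; split; first exact: convex_functions_midpoint.
    have Sm := convex_functions_midpoint cS Sf Sg.
    have le_m : J (fun x => (f x + g x) / 2) <= 2^-1 * (J f + J g).
      rewrite /J -RintegralD//; [|exact: iphi|exact: iphi].
      rewrite -RintegralZl//; last first.
        by apply/bmeas_integrable/bmeasD; apply: bmeasX; exact: bphi.
      apply: le_Rintegral => //; first exact: iphi.
        apply/bmeas_integrable/bmeasZ/bmeasD; apply: bmeasX; exact: bphi.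
      move=> x _; rewrite mulrC; apply: le_trans (sqr_pos_part_midpoint _ _).
      by rewrite /phi (_ : _ - c = (f x - c + (g x - c)) / 2)//; lra.
    by apply: le_trans le_m _; move: Jf Jg; move: (J f) (J g) (_^-1) => *; lra.
  - move=> n; have e0 : 0 < n.+1%:R^-1 :> R by rewrite invr_gt0.
    have [_ [k Sk <-] Jk] := inf_adherent e0 J_inf.
    exists k; first by split=> //; exact: ltW.
    rewrite -Rintegral_cst//; apply: le_Rintegral => //.
    + by apply/bmeas_integrable/bmeasX; have [] := bS _ Sk.
    + exact/bmeas_integrable/bmeas_cst.
    + move=> x _; have [_ /(_ x)/andP[k_ge0 kM]] := bS _ Sk.
      by rewrite lerXn2r ?nnegrE.
have Su n : S (u n) by have [] := uS n.
have mu_ n : measurable_fun setT (u n) by have [[]] := bS _ (Su n).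
have [l ml ul] := ae_limit mu_ ucvg.
(* Clamping changes [l] only on a null set and restores the bounds at every point, as the closedness
   of [S] requires. *)
pose k' x := Num.max 0 (Num.min M (l x)).
have bk' x : 0 <= k' x <= M.
  by rewrite /k' le_max lexx ge_max M0 ge_min lexx.
have mk' : measurable_fun setT k'.
  by apply: measurable_maxr => //; exact: measurable_minr.
have uk' : {ae mu, forall x, u n x @[n --> \oo] --> k' x}.
  apply: filterS ul => x ulx; suff -> : k' x = l x by [].
  rewrite /k' min_r ?max_r//.
    apply: (cvgr_to_ge ulx); apply: nearW => n.
    by have [_ /(_ x)/andP[]] := bS _ (Su n).
  apply: (cvgr_to_le ulx); apply: nearW => n.
  by have [_ /(_ x)/andP[]] := bS _ (Su n).
have Sk' : S k' by exact: clS uk'.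
have Jk' : J k' <= j.
  have Ju : J (u n) @[n --> \oo] --> J k'.
    apply: (@Rintegral_bounded_cvg _ _ _ _ _ _ (M ^+ 2)).
    - by move=> n; have [] := bmeasX 2 (bphi _ (Su n)).
    - by have [] := bmeasX 2 (bphi _ Sk').
    - apply: filterS uk' => x ukx.
      pose psi (y : R) := Num.max (y - c) 0 ^+ 2.
      have cpsi : continuous psi.
        move=> y; apply: (@continuous_comp _ _ _ (fun y => Num.max (y - c) 0)
          (fun z => z ^+ 2)); last exact: exprn_continuous.
        apply: continuous_max; last exact: cst_continuous.
        by apply: continuousB; [exact: cvg_id|exact: cst_continuous].
      have h := cvg_comp _ _ ukx (cpsi (k' x)).
      exact: h.
    - move=> n x; have [_ /(_ x)/andP[u0 uM]] := bS _ (Su n).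
      rewrite ger0_norm ?sqr_ge0// lerXn2r ?nnegrE//.
        by rewrite le_max lexx orbT.
      by rewrite ge_max M0 andbT; lra.
  have jn : j + n.+1%:R^-1 @[n --> \oo] --> j.
    rewrite -[X in _ --> X]addr0; apply: cvgD; first exact: cvg_cst.
    exact: cvg_harmonic.
  by apply: (ler_cvg_to Ju jn); apply: nearW => n; have [] := uS n.
pose v := phi k'.
have bv : bmeas T R v := bphi _ Sk'.
have v0 x : 0 <= v x by rewrite /v /phi le_max lexx orbT.
have vk k : S k -> c * \int[mu]_x v x <= \int[mu]_x (v x * k x).
  move=> Sk; have [bk k_bd] := bS _ Sk; have [bkk' _] := bS _ Sk'.
  pose h x := k x - k' x.
  have bh : bmeas T R h by exact: bmeasB.
  have : 0 <= \int[mu]_x (v x * h x).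
    apply: (@first_order_ge0 _ _ (\int[mu]_x h x ^+ 2)).
      by apply: Rintegral_ge0 => x _; exact: sqr_ge0.
    move=> t t0 t1; pose kt x := t * k x + (1 - t) * k' x.
    have Skt : S kt by apply: cS => //; rewrite t1 ltW.
    have : J kt <= J k' + 2 * t * \int[mu]_x (v x * h x)
        + t ^+ 2 * \int[mu]_x h x ^+ 2.
      rewrite -!RintegralZl//; last 2 first.
      - exact/bmeas_integrable/bmeasX.
      - exact/bmeas_integrable/bmeasM.
      have b1 := bmeasX 2 bv.
      have b2 : bmeas T R (fun x => 2 * t * (v x * h x)) by exact/bmeasZ/bmeasM.
      have b3 : bmeas T R (fun x => t ^+ 2 * h x ^+ 2) by exact/bmeasZ/bmeasX.
      rewrite /J -/v -!RintegralD//; try by apply/bmeas_integrable => //; exact: bmeasD.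
      apply: le_Rintegral => //; first exact: iphi.
        by apply/bmeas_integrable; do 2 apply: bmeasD => //.
      move=> x _; have := sqr_pos_part_smooth (k' x - c) (t * h x).
      rewrite /phi /kt -/(phi k' x) -/v -/(v x).
      rewrite (_ : k' x - c + _ = t * k x + (1 - t) * k' x - c); last first.
        by rewrite /h; lra.
      by move/le_trans; apply; rewrite exprMn; lra.
    by have := jJ _ Skt; lra.
  rewrite (_ : (fun x => v x * h x) = (fun x => v x * k x - v x * k' x));
    last by apply/funext => x; rewrite mulrBr.
  rewrite RintegralB//; try exact/bmeas_integrable/bmeasM.
  rewrite subr_ge0; apply: le_trans; rewrite -RintegralZl//; last first.
    exact: bmeas_integrable.
  apply: le_Rintegral => //; first exact/bmeas_integrable/bmeasZ.
    exact/bmeas_integrable/bmeasM.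
  (* [v] vanishes where [k' <= c], hence [c * v <= v * k'] pointwise. *)
  by move=> x _; rewrite /v /phi; case: (lerP (k' x - c) 0) => ?; nra.
(* A zero integral would force [k' <= c] a.e., which no element of [S] satisfies. *)
have iv_gt0 : 0 < \int[mu]_x v x.
  rewrite lt_neqAle Rintegral_ge0 ?andbT//; apply/eqP => iv0.
  apply: (Sc _ Sk').
  have : (\int[mu]_x `|(v x)%:E| = 0)%E.
    under eq_integral do rewrite gee0_abs ?lee_fin//.
    by rewrite -EFin_Rintegral -?iv0//; exact: bmeas_integrable.
  move/ae_eq_integral_abs => /(_ measurableT).
  have /measurable_EFinP mv : measurable_fun setT v by case: bv.
  move=> /(_ mv); apply: filterS => x /(_ I)/= [vx0].
  have : k' x - c <= v x by rewrite le_max lexx.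
  by rewrite vx0 subr_le0.
set a := \int[mu]_x v x in vk iv_gt0.
exists (fun x => a^-1 * v x); split.
- exact: bmeasZ.
- by move=> x; rewrite mulr_ge0// invr_ge0 ltW.
- by rewrite RintegralZl//; [rewrite mulVf// gt_eqF|exact: bmeas_integrable].
- move=> k Sk; have [bk _] := bS _ Sk.
  under eq_Rintegral do rewrite -mulrA.
  rewrite RintegralZl//; last exact/bmeas_integrable/bmeasM.
  by rewrite mulrC ler_pdivlMr// vk.
Qed.

(** * Separation without a uniform bound *)

(** The partial weight [w n] handles the elements of [C] that are a.e. at most [M n]. Every element
    is bounded, so the total weight [W] handles all of [C]; normalising [W] gives the density of
    [nu]. *)
Lemma positive_krein_smulian d (T : measurableType d) (R : realType)
    (mu : {finite_measure set T -> \bar R}) (C : set (T -> R)) (c : R) :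
    0 < c -> (exists k, C k) ->
    (forall k, C k -> bmeas T R k /\ forall x, 0 <= k x) ->
    convex_functions C ->
    (forall (u : nat -> T -> R) (k : T -> R) M, (forall n, C (u n)) ->
       (forall n x, u n x <= M) -> bmeas T R k -> (forall x, 0 <= k x) ->
       {ae mu, forall x, u n x @[n --> \oo] --> k x} -> C k) ->
    (forall k, C k -> ~ {ae mu, forall x, k x <= c}) ->
  exists2 nu : probability T R, nu `<< mu &
    exists2 a : R, 0 < a & forall k, C k -> a <= \int[nu]_x k x.
Proof.
move=> c0 [k0 Ck0] bC cC clC Cc.
pose M n : R := c * 2 ^+ n.
have M0 n : 0 < M n by rewrite mulr_gt0// exprn_gt0.
pose good (w : T -> R) := bmeas T R w /\ forall x, 0 <= w x.
pose H n w := forall k, C k -> {ae mu, forall x, k x <= M n} ->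
  1 < \int[mu]_x (k x * w x).
(* The assumptions on [p] sit under the existential so that [choice] yields a function on all pairs;
   when they fail, any [v] will do. *)
have step (p : nat * (T -> R)) : exists v, good p.2 ->
    [/\ good v, \int[mu]_x v x <= 2 / M p.1 &
        H p.1 p.2 -> H p.1.+1 (fun x => p.2 x + v x)].
  case: p => n w /=; have [[bw w0]|] := pselect (good w); last by exists w.
  (* [S] collects the [k] that [w] does not handle yet; they exceed [M n] on a set
     of positive measure, hence a mass [2 / M n] suffices for them. *)
  have [Hw|nHw] := pselect (H n w); last first.
    exists (fun=> 0) => _; split=> //; first by split=> //; exact: bmeas_cst.
    by rewrite Rintegral_cst// mul0r divr_ge0// ltW.
  pose S := [set k | [/\ C k, forall x, k x <= M n.+1 &
                        \int[mu]_x (k x * w x) <= 1]].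
  have [v [bv v0 iv Sv]] : exists v : T -> R, [/\ bmeas T R v,
      forall x, 0 <= v x, \int[mu]_x v x <= 1 &
      forall k, S k -> M n <= \int[mu]_x (v x * k x)].
    apply: (@bounded_convex_separation _ _ _ _ S (M n) (M n.+1)) => //.
    - exact/ltW.
    - exact/ltW.
    - move=> k [/bC[bk k_ge0] kM _]; split=> // x; rewrite kM andbT.
      exact: k_ge0.
    - move=> f g t [Cf fM fw] [Cg gM gw] t01; have /andP[t0 t1] := t01.
      have [[bf _] [bg _]] := (bC _ Cf, bC _ Cg).
      split; first exact: cC.
        by move=> x; have := fM x; have := gM x; move: (M n.+1) => N *; nra.
      have -> : \int[mu]_x ((t * f x + (1 - t) * g x) * w x) =
          t * \int[mu]_x (f x * w x) + (1 - t) * \int[mu]_x (g x * w x).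
        rewrite -!RintegralZl//; try by apply/bmeas_integrable/bmeasM.
        rewrite -RintegralD//; try by apply/bmeas_integrable/bmeasZ/bmeasM.
        by apply: eq_Rintegral => x _; rewrite mulrDl !mulrA.
      move: fw gw; move: (Rintegral _ _ _) (Rintegral _ _ _) => *; nra.
    - move=> u k uS mk kM uk.
      have bk : bmeas T R k.
        apply/bmeasP; split=> //; exists (M n.+1) => x.
        by have /andP[? ?] := kM x; rewrite ger0_norm.
      have k_ge0 x : 0 <= k x by have /andP[] := kM x.
      split.
      + apply: (clC u k (M n.+1)) => //; first by move=> m; have [] := uS m.
        by move=> m x; have [] := uS m.
      + by move=> x; have /andP[] := kM x.
      have [mw [N wN]] := (bmeasP w).1 bw.
      have cu : \int[mu]_x (u m x * w x) @[m --> \oo] --> \int[mu]_x (k x * w x).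
        apply: (@Rintegral_bounded_cvg _ _ _ _ _ _ (M n.+1 * N)).
        * by move=> m; have [Cu _ _] := uS m; have [bu _] := bC _ Cu;
            have [] := bmeasM bu bw.
        * by have [] := bmeasM bk bw.
        * by apply: filterS uk => x ukx; apply: cvgM => //; exact: cvg_cst.
        * move=> m x; have [Cu uM _] := uS m; have [_ u0] := bC _ Cu.
          by rewrite normrM ler_pM// ger0_norm.
      by apply: (cvgr_to_le cu); apply: nearW => m; have [] := uS m.
    - move=> k [Ck _ kw] /(Hw _ Ck); by rewrite ltNge kw.
  exists (fun x => 2 / M n * v x) => _.
  have b0 : 0 <= 2 / M n by rewrite divr_ge0// ltW.
  split.
  - by split; [exact: bmeasZ|move=> x; rewrite mulr_ge0].
  - rewrite RintegralZl//; last exact: bmeas_integrable.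
    by rewrite -[leRHS]mulr1 ler_wpM2l.
  move=> _ k Ck kM; have [bk k_ge0] := bC _ Ck.
  (* [S] asks for the bound at every point, whereas [k] satisfies it only a.e.; the constant
     sequence [k] converges a.e. to [kt], so [kt] is in [C]. *)
  pose kt x := Num.min (k x) (M n.+1).
  have bkt : bmeas T R kt by apply: bmeas_min => //; exact: bmeas_cst.
  have kt0 x : 0 <= kt x by rewrite le_min k_ge0 ltW.
  have kkt : {ae mu, forall x, k x = kt x}.
    by apply: filterS kM => x kx; rewrite /kt min_l.
  have Ckt : C kt.
    have [_ [N kN]] := (bmeasP k).1 bk.
    apply: (clC (fun=> k) kt N) => //.
      by move=> _ x; rewrite (le_trans (ler_norm _)).
    by apply: filterS kkt => x <-; exact: cvg_cst.
  have bwv : bmeas T R (fun x => w x + 2 / M n * v x).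
    by apply: bmeasD => //; exact: bmeasZ.
  have -> : \int[mu]_x (k x * (w x + 2 / M n * v x)) =
      \int[mu]_x (kt x * w x) + 2 / M n * \int[mu]_x (v x * kt x).
    rewrite -RintegralZl//; last exact/bmeas_integrable/bmeasM.
    rewrite -RintegralD//; first last.
    - exact/bmeas_integrable/bmeasZ/bmeasM.
    - exact/bmeas_integrable/bmeasM.
    congr fine; apply: ae_eq_integral => //.
    - by apply/measurable_EFinP; have [] := bmeasM bk bwv.
    - apply/measurable_EFinP.
      by have [] := bmeasD (bmeasM bkt bw) (bmeasZ (2 / M n) (bmeasM bv bkt)).
    - by apply: filterS kkt => x /= -> _; congr EFin; ring.
  have I1 : 0 <= \int[mu]_x (kt x * w x).
    by apply: Rintegral_ge0 => x _; rewrite mulr_ge0.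
  have I2 : 0 <= \int[mu]_x (v x * kt x).
    by apply: Rintegral_ge0 => x _; rewrite mulr_ge0.
  (* Either the old weight already suffices, or [kt] is in [S] and the new term contributes at least
     [2 / M n * M n = 2]. *)
  have [ktw|ktw] := leP (\int[mu]_x (kt x * w x)) 1; last first.
    by rewrite (lt_le_trans ktw)// lerDl mulr_ge0.
  have Skt : S kt by split=> // x; rewrite /kt ge_min lexx orbT.
  have := Sv _ Skt; rewrite -(ler_pM2l (_ : 0 < 2 / M n)); last by rewrite divr_gt0.
  by rewrite divfK ?gt_eqF// => ?; lra.
have [f fP] := choice step.
pose w n := iteri n (fun i w x => w x + f (i, w) x) (fun=> 0) : T -> R.
have gw n : good (w n).
  elim: n => [|n IH]; first by split=> //; exact: bmeas_cst.
  have [[bv v0] _ _] := fP (n, w n) IH; have [bw w0] := IH.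
  by split; [exact: bmeasD|move=> x; rewrite addr_ge0].
pose v n := f (n, w n).
have bv n : bmeas T R (v n) by have [[]] := fP (n, w n) (gw n).
have v0 n x : 0 <= v n x by have [[_ /(_ x)]] := fP (n, w n) (gw n).
have iv n : \int[mu]_x v n x <= 2 / c * 2^-1 ^+ n.
  have [_ + _] := fP (n, w n) (gw n); move/le_trans; apply.
  by rewrite /= /M invfM exprVn mulrA.
(* The case [n = 0] is vacuous: [M 0 = c], and no element of [C] is a.e. at most [c]. *)
have Hw n : H n (w n).
  elim: n => [|n IH]; last by have [_ _] := fP (n, w n) (gw n); exact.
  by move=> k /Cc; rewrite /M expr0 mulr1.
have wE n x : w n x = \sum_(0 <= i < n) v i x.
  elim: n => [|n IH]; first by rewrite big_geq.
  by rewrite big_nat_recr//= -IH.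
pose W x := (\sum_(n <oo) (v n x)%:E)%E.
have iW : mu.-integrable setT W := integrable_geometric_series bv v0 iv.
have mW : measurable_fun setT W by exact: measurable_int iW.
have W0 x : (0 <= W x)%E by apply: nneseries_ge0 => *; rewrite lee_fin.
have wW n x : ((w n x)%:E <= W x)%E.
  by rewrite wE -sumEFin; apply: nneseries_lim_ge => *; rewrite lee_fin.
have kW k : C k -> exists2 n, (1 < \int[mu]_x (k x * w n x)) &
    ((\int[mu]_x (k x * w n x))%:E <= \int[mu]_x ((k x)%:E * W x))%E.
  move=> Ck; have [bk k_ge0] := bC _ Ck; have [mk [N kN]] := (bmeasP k).1 bk.
  have [n Nn] : exists n, N <= M n.
    exists (Num.bound (`|N| / c)).
    have := upper_nthrootP (leqnn (Num.bound (`|N| / c))).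
    by rewrite ltr_pdivrMr// mulrC => /ltW; apply: le_trans; exact: ler_norm.
  exists n.
    apply: Hw => //; apply: aeW => x.
    by rewrite (le_trans (ler_norm _))// (le_trans (kN x)).
  have [bw w0] := gw n.
  rewrite EFin_Rintegral; last exact/bmeas_integrable/bmeasM.
  apply: ge0_le_integral => //.
  - by move=> x _; rewrite lee_fin mulr_ge0.
  - by apply/measurable_EFinP; have [] := bmeasM bk bw.
  - by apply: emeasurable_funM => //; exact/measurable_EFinP.
  - by move=> x _; rewrite EFinM lee_wpmul2l// lee_fin.
pose s := fine (\int[mu]_x W x)%E.
have sE : (s%:E = \int[mu]_x W x)%E by rewrite fineK// integrable_fin_num.
(* If [W] had mass 0, the bounded [k0] would integrate to 0 against it, yet this integral exceeds
   1. *)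
have s0 : 0 < s.
  rewrite lt_neqAle -lee_fin sE integral_ge0// andbT; apply/eqP => s0.
  have [n n1 nW] := kW _ Ck0; have [_ [N kN]] := (bmeasP k0).1 (bC _ Ck0).1.
  have : (\int[mu]_x ((k0 x)%:E * W x) <= `|N|%:E * \int[mu]_x W x)%E.
    rewrite -integralZl//; apply: ge0_le_integral => //.
    - by move=> x _; rewrite mule_ge0// lee_fin (bC _ Ck0).2.
    - apply: emeasurable_funM => //; apply/measurable_EFinP.
      by have [[]] := bC _ Ck0.
    - by apply: emeasurable_funM => //; exact: measurable_cst.
    - move=> x _; rewrite lee_wpmul2r// lee_fin.
      by rewrite (le_trans (ler_norm _))// (le_trans (kN x))// ler_norm.
  by rewrite -sE -s0 mule0 => /(le_trans nW); rewrite lee_fin => ?; lra.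
have [|||nu numu nuE] := @exists_density _ _ _ mu (fun x => s^-1%:E * W x)%E.
- by apply: emeasurable_funM => //; exact: measurable_cst.
- by move=> x; rewrite mule_ge0// lee_fin invr_ge0 ltW.
- by rewrite integralZl// -sE -EFinM mulVf// gt_eqF.
exists nu => //; exists s^-1; first by rewrite invr_gt0.
move=> k Ck; have [bk k_ge0] := bC _ Ck; have [mk _] := bk.
rewrite -lee_fin EFin_Rintegral; last exact: bmeas_integrable.
rewrite nuE//.
have [n /ltW kw1 kwW] := kW _ Ck.
have -> : (\int[mu]_x ((k x)%:E * (s^-1%:E * W x)) =
    s^-1%:E * \int[mu]_x ((k x)%:E * W x))%E.
  rewrite -ge0_integralZl//; first by under eq_integral do rewrite muleCA.
  - by apply: emeasurable_funM => //; exact/measurable_EFinP.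
  - by move=> x _; rewrite mule_ge0// lee_fin.
  - by rewrite lee_fin invr_ge0 ltW.
rewrite -[leLHS]mule1; apply: lee_wpmul2l.
  by rewrite lee_fin invr_ge0 ltW.
by apply: le_trans kwW; rewrite lee_fin.
Qed.

(** * Approximate subgradients of a convex risk mapping *)

Lemma Rintegral_probability_cst d (T : measurableType d) (R : realType)
    (P : probability T R) (c : R) : \int[P]_x c = c.
Proof.
rewrite Rintegral_cst//; set p := fine _.
by rewrite (_ : p = 1) ?mulr1//; exact: (congr1 fine (probability_setT P)).
Qed.

(** [exists_density] speaks of nonnegative [g]; a bounded [g] is shifted up by a bound [N], whose
    contribution cancels. *)
Lemma exists_real_density d (T : measurableType d) (R : realType)
    (mu : {finite_measure set T -> \bar R}) (h : T -> R) :
    mu.-integrable setT (EFin \o h) -> (forall x, 0 <= h x) ->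
    0 < \int[mu]_x h x ->
  exists2 nu : probability T R, nu `<< mu &
    forall g, bmeas T R g ->
      \int[nu]_x g x = (\int[mu]_x (h x * g x)) / \int[mu]_x h x.
Proof.
move=> ih h0; set s := \int[mu]_x h x => s0.
have sE : (s%:E = \int[mu]_x (h x)%:E)%E by rewrite /s EFin_Rintegral.
have /measurable_EFinP mh := measurable_int _ ih.
have iM g : bmeas T R g -> mu.-integrable setT (EFin \o (fun x => h x * g x)).
  move=> [mg bg]; have := integrableMl measurableT ih mg bg.
  by apply: eq_integrable.
have [|||nu numu nuE] := @exists_density _ _ _ mu (fun x => s^-1%:E * (h x)%:E)%E.
- by apply: emeasurable_funM => //; exact/measurable_EFinP.
- by move=> x; rewrite mule_ge0// lee_fin// invr_ge0 ltW.
- by rewrite integralZl// -sE -EFinM mulVf// gt_eqF.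
exists nu => // g bg; have [mg [N gN]] := (bmeasP g).1 bg.
have bgN : bmeas T R (fun x => g x + N) by apply: bmeasD => //; exact: bmeas_cst.
have gN0 x : 0 <= g x + N.
  by have := gN x; rewrite ler_norml => /andP[]; lra.
have mgN : measurable_fun setT (fun x => g x + N) by case: bgN.
have : \int[nu]_x (g x + N) = s^-1 * \int[mu]_x (h x * (g x + N)).
  rewrite -RintegralZl//; last exact: iM.
  rewrite /Rintegral nuE//; congr fine; apply: eq_integral => x _.
  by rewrite -!EFinM; congr EFin; ring.
rewrite RintegralD//; last 2 first.
- exact: bmeas_integrable.
- exact/bmeas_integrable/bmeas_cst.
rewrite Rintegral_probability_cst.
have -> : \int[mu]_x (h x * (g x + N)) = \int[mu]_x (h x * g x) + N * s.
  rewrite /s -RintegralZl// -RintegralD//; last 2 first.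
  - exact: iM.
  - by have := iM _ (bmeas_cst T N); apply: eq_integrable => // x _ /=; rewrite mulrC.
  by apply: eq_Rintegral => x _; ring.
rewrite mulrDr mulrCA mulVf ?gt_eqF// mulr1 => /addIr ->.
by rewrite mulrC.
Qed.

(* The running suprema of [u] decrease to [k], so continuity from below applies
   to their negatives. *)
Lemma risk_lower_semicontinuous d (T : measurableType d) (R : realType)
    (mu : probability T R) (r : (T -> R) -> R) (f : T -> R) (b M : R)
    (u : nat -> T -> R) (k : T -> R) :
    risk_mapping mu r -> risk_continuous_from_below mu r -> bmeas T R f ->
    (forall n, bmeas T R (u n)) -> (forall n x, 0 <= u n x <= M) ->
    (forall n, r (fun x => f x - u n x) <= b) ->
    bmeas T R k -> {ae mu, forall x, u n x @[n --> \oo] --> k x} ->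
  r (fun x => f x - k x) <= b.
Proof.
move=> rr rc bf bu uM rb bk uk.
have ub x : has_ubound (range (u ^~ x)).
  by exists M => _ [n _ <-]; have /andP[] := uM n x.
pose h n x := sups (u ^~ x) n.
have uh n x : u n x <= h n x.
  by apply: ub_le_sup; [exact/has_ubound_sdrop/ub|exists n => /=].
have hM n x : h n x <= M.
  apply: ge_sup; first by exists (u n x), n => /=.
  by move=> _ [m _ <-]; have /andP[] := uM m x.
have bh n : bmeas T R (h n).
  apply/bmeasP; split.
    by apply: measurable_fun_sups => // m; have [] := bu m.
  exists M => x; rewrite ger0_norm//; apply: le_trans (uh n x).
  by have /andP[] := uM n x.
have cr : r (fun x => f x - h n x) @[n --> \oo] --> r (fun x => f x - k x).
  apply: rc.
  - by move=> n; exact: bmeasB.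
  - exact: bmeasB.
  - by move=> n x; rewrite lerD2l lerN2 (nonincreasing_sups (ub x)).
  - apply: filterS uk => x ukx; apply: cvgB; first exact: cvg_cst.
    exact: cvg_sups.
apply: (cvgr_to_le cr); apply: nearW => n; apply: le_trans (rb n).
apply: (risk_monotone rr); [exact: bmeasB|exact: bmeasB|].
by apply: aeW => x; rewrite lerD2l lerN2.
Qed.

(** Under the law [nu] the means of elements of [C] are at least [a > 0], hence so are their L^2
    norms. The limit [h] of a minimising sequence in [C], once normalised, is the density of [Q]
    with respect to [nu]. *)
Lemma approximate_subgradient d (T : measurableType d) (R : realType)
    (mu : probability T R) (r : (T -> R) -> R) (f : T -> R) (e : R) :
    risk_mapping mu r -> risk_convex r -> risk_continuous_from_below mu r ->
    bmeas T R f -> 0 < e ->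
  exists2 Q : probability T R, Q `<< mu &
    forall g, bmeas T R g -> r f - e + (\int[Q]_x g x - \int[Q]_x f x) <= r g.
Proof.
move=> rr rcv rc bf e0.
have rB g c : bmeas T R g -> r (fun x => g x - c) = r g - c.
  by move=> bg; rewrite (risk_translation rr)// addrC.
pose C' := [set k | bmeas T R k /\ r (fun x => f x - k x) <= r f - e].
pose C := [set k | C' k /\ forall x, 0 <= k x].
have C'e : C' (fun=> e) by split; [exact: bmeas_cst|rewrite rB].
have Ce : C (fun=> e) by split=> // _; exact: ltW.
have C'up k k' : C' k -> bmeas T R k' -> {ae mu, forall x, k x <= k' x} -> C' k'.
  move=> [bk rk] bk' kk'; split=> //; apply: le_trans rk.
  apply: (risk_monotone rr); [exact: bmeasB|exact: bmeasB|].
  by apply: filterS kk' => x; rewrite lerD2l lerN2.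
have C'cv : convex_functions C'.
  move=> k k' t [bk rk] [bk' rk'] t01; split.
    by apply: bmeasD; exact: bmeasZ.
  rewrite (_ : (fun x => _) =
      (fun x => t * (f x - k x) + (1 - t) * (f x - k' x))); last first.
    by apply/funext => x; ring.
  apply: (le_trans (rcv _ _ _ t01 (bmeasB bf bk) (bmeasB bf bk'))).
  have /andP[t0 t1] := t01.
  rewrite (_ : r f - e = t * (r f - e) + (1 - t) * (r f - e)); last by ring.
  by rewrite lerD// ler_wpM2l// subr_ge0.
have [||||||nu numu [a a0 aC]] := @positive_krein_smulian _ _ _ mu C (e / 2).
- by rewrite divr_gt0.
- by exists (fun=> e).
- by move=> k [[bk _] k0].
- move=> k k' t [Ck k0] [Ck' k0'] t01; split; first exact: C'cv.
  by move=> x; have /andP[t0 t1] := t01; rewrite addr_ge0// mulr_ge0// subr_ge0.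
- move=> u k M uC uM bk k0 uk; split=> //; split=> //.
  apply: (@risk_lower_semicontinuous _ _ _ mu r f _ M u k) => //.
  + by move=> n; have [[]] := uC n.
  + by move=> n x; rewrite uM andbT; have [_] := uC n.
  + by move=> n; have [[]] := uC n.
(* Otherwise the constant [e / 2] would lie in [C'], that is, [r f - e / 2 <= r f - e]. *)
- move=> k [Ck _] ke.
  have [_] := C'up _ _ Ck (bmeas_cst _ _) ke.
  by rewrite rB//; lra.
(* With a constant family of sets, the selection is a minimising sequence for the L^2 norm on
   [C]. *)
have [] := @nested_convex_selection _ _ _ nu (fun=> C) (\int[nu]_x e ^+ 2).
- by move=> n k.
- by move=> _ k [[]].
- move=> _ k k' [Ck k0] [Ck' k0']; split; first exact: convex_functions_midpoint.
  by move=> x; rewrite divr_ge0// addr_ge0.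
- by move=> _; exists (fun=> e).
move=> u [uC umin ucvg [G iG uG]].
have bu n : bmeas T R (u n) by have [[]] := uC n.
have u0 n x : 0 <= u n x by have [_] := uC n.
have mu_ n : measurable_fun setT (u n) by have [] := bu n.
have [l ml ul] := ae_limit mu_ ucvg.
pose h x := Num.max 0 (l x).
have mh : measurable_fun setT h by exact: measurable_maxr.
have h0 x : 0 <= h x by rewrite le_max lexx.
have uh : {ae nu, forall x, u n x @[n --> \oo] --> h x}.
  apply: filterS ul => x ulx; rewrite /h max_r//.
  by apply: (cvgr_to_ge ulx); apply: nearW.
have [ih _] := Rintegral_dominated_cvg mu_ mh uh iG uG.
have uk_cvg k : bmeas T R k ->
    \int[nu]_x (u n x * k x) @[n --> \oo] --> \int[nu]_x (h x * k x).
  move=> bk; have [mk [N kN]] := (bmeasP k).1 bk.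
  apply: (Rintegral_dominated_cvg _ _ _ (integrableZl measurableT N iG) _).2.
  - by move=> n; exact: measurable_funM.
  - exact: measurable_funM.
  - by apply: filterS uh => x uhx; apply: cvgM => //; exact: cvg_cst.
  - move=> n x; rewrite normrM mulrC EFinM.
    by apply: lee_pmul; rewrite ?lee_fin.
(* Cauchy-Schwarz against the constant 1, obtained by expanding a square. *)
have a_le n : a ^+ 2 <= \int[nu]_x u n x ^+ 2.
  have : 0 <= \int[nu]_x (u n x - a) ^+ 2.
    by apply: Rintegral_ge0 => x _; exact: sqr_ge0.
  have -> : \int[nu]_x (u n x - a) ^+ 2 =
      \int[nu]_x u n x ^+ 2 - 2 * a * \int[nu]_x u n x + a ^+ 2.
    rewrite -RintegralZl//; last exact: bmeas_integrable.
    rewrite -RintegralB//; first last.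
    - exact/bmeas_integrable/bmeasZ.
    - exact/bmeas_integrable/bmeasX.
    have -> : a ^+ 2 = \int[nu]_x (a ^+ 2).
      by rewrite Rintegral_probability_cst.
    rewrite -RintegralD//; first last.
    - exact/bmeas_integrable/bmeas_cst.
    - by apply/bmeas_integrable/bmeasB; [exact: bmeasX|exact: bmeasZ].
    by apply: eq_Rintegral => x _; ring.
  by have := aC _ (uC n); nra.
have sep k : C' k -> a ^+ 2 <= \int[nu]_x (h x * k x).
  move=> Ck; have [bk _] := Ck.
  set L := \int[nu]_x (h x * k x); pose K := \int[nu]_x k x ^+ 2.
  have K0 : 0 <= K by apply: Rintegral_ge0 => x _; exact: sqr_ge0.
  (* The variational inequality is written for [u n] and passed to the limit afterwards, since only
     integrability of [h] is at hand, not that of its square. *)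
  have step t n : 0 < t -> t <= 1 -> (2 * t - t ^+ 2) * a ^+ 2 <=
      t ^+ 2 * K + 2 * t * (1 - t) * \int[nu]_x (u n x * k x) + 4^-1 ^+ n.
    move=> t0 t1; have t01 : 0 <= t <= 1 by rewrite t1 ltW.
    pose kt x := t * k x + (1 - t) * u n x.
    have C'kt : C' kt by apply: C'cv => //; have [] := uC n.
    have bkt : bmeas T R kt by case: C'kt.
    (* Passing to the positive part stays in [C'] and does not increase the norm; this extends the
       separation from [C] to [C']. *)
    have Ck1 : C (fun x => Num.max (kt x) 0).
      split; last by move=> x; rewrite le_max lexx orbT.
      apply: (C'up _ _ C'kt).
        by apply: bmeas_max => //; exact: bmeas_cst.
      by apply: aeW => x; rewrite le_max lexx.
    have le1 : \int[nu]_x Num.max (kt x) 0 ^+ 2 <= \int[nu]_x kt x ^+ 2.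
      apply: le_Rintegral => //.
      - by case: Ck1 => -[b1 _] _; exact/bmeas_integrable/bmeasX.
      - exact/bmeas_integrable/bmeasX.
      - by move=> x _; case: (lerP (kt x) 0) => _ //; rewrite expr0n sqr_ge0.
    have ktE : \int[nu]_x kt x ^+ 2 = t ^+ 2 * K +
        2 * t * (1 - t) * \int[nu]_x (u n x * k x) +
        (1 - t) ^+ 2 * \int[nu]_x u n x ^+ 2.
      have b1 := bmeasX 2 bk; have b2 := bmeasM (bu n) bk.
      have b3 := bmeasX 2 (bu n).
      rewrite /K -!RintegralZl//; try exact: bmeas_integrable.
      rewrite -!RintegralD//;
        try by apply/bmeas_integrable; do ?apply: bmeasD; exact: bmeasZ.
      by apply: eq_Rintegral => x _; rewrite /kt; ring.
    have := le_trans (umin _ (fun=> Ck1) n) (lerD le1 (lexx _)).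
    have := a_le n; rewrite ktE.
    move: (\int[nu]_x u n x ^+ 2) (\int[nu]_x (u n x * k x)) => U V aU UX.
    have : 0 <= t * (2 - t) * (U - a ^+ 2) by rewrite !mulr_ge0//; lra.
    by lra.
  have lim_step t : 0 < t -> t <= 1 -> (2 * t - t ^+ 2) * a ^+ 2 <=
      t ^+ 2 * K + 2 * t * (1 - t) * L.
    move=> t0 t1.
    have cV : t ^+ 2 * K + 2 * t * (1 - t) * \int[nu]_x (u n x * k x) + 4^-1 ^+ n
        @[n --> \oo] --> t ^+ 2 * K + 2 * t * (1 - t) * L + 0.
      apply: cvgD; last first.
        by apply: cvg_expr; rewrite ger0_norm ?invf_lt1 ?ltr1n.
      apply: cvgD; first exact: cvg_cst.
      by apply: cvgM; [exact: cvg_cst|exact: uk_cvg].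
    by rewrite -[leRHS]addr0; apply: (cvgr_to_ge cV); apply: nearW => n; exact: step.
  (* The summand with [|L|] absorbs [- 2 * t ^+ 2 * L] and keeps the coefficient nonnegative. *)
  rewrite -subr_ge0; apply: (@first_order_ge0 _ _ (K + a ^+ 2 + 2 * `|L|)).
    by rewrite !addr_ge0 ?sqr_ge0// mulr_ge0.
  move=> t t0 t1; have := lim_step t t0 t1; have := ler_norm L.
  have := ler_norm (- L); rewrite normrN.
  move: (a ^+ 2) `|L| => A N LN LN' ineq.
  have : 0 <= t ^+ 2 * (N + L) by rewrite mulr_ge0 ?sqr_ge0//; lra.
  by nra.
(* The constant [e] is in [C'], so separation bounds [e] times this integral below by [a ^+ 2]. *)
have ih0 : 0 < \int[nu]_x h x.
  have := sep _ C'e; rewrite RintegralZr// => ?.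
  by rewrite -(pmulr_lgt0 _ e0); apply: lt_le_trans (exprn_gt0 2 a0) _.
have [Q Qnu QE] := exists_real_density ih h0 ih0.
exists Q; first exact: null_dominates_trans Qnu numu.
(* Chosen so that [r (g - c) = r f - e], the boundary case of membership in [C']. *)
move=> g bg; pose c := r g - r f + e.
pose k x := f x - (g x - c).
have bgc : bmeas T R (fun x => g x - c) by apply: bmeasB => //; exact: bmeas_cst.
have C'k : C' k.
  split; first exact: bmeasB.
  rewrite (_ : (fun x => _) = (fun x => g x - c)) ?rB// /c; first by lra.
  by apply/funext => x; rewrite /k subKr.
have : 0 <= \int[Q]_x k x.
  rewrite QE; last by case: C'k.
  by apply: divr_ge0; [exact: le_trans (sqr_ge0 a) (sep _ C'k)|exact: ltW].
rewrite RintegralB//; try exact: bmeas_integrable.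
rewrite RintegralB//; try by apply: bmeas_integrable => //; exact: bmeas_cst.
by rewrite Rintegral_probability_cst /c; lra.
Qed.

(** * Risk mappings under the law of a random variable *)

Section risk_of_law.
Context d d' (T : measurableType d) (T' : measurableType d') (R : realType).
Variables (P : probability T R) (X : {mfun T >-> T'}) (rho : (T -> R) -> R).

Lemma ae_distribution (A : T' -> Prop) :
  {ae distribution P X, forall y, A y} -> {ae P, forall x, A (X x)}.
Proof.
move=> [N [mN N0 AN]]; exists (X @^-1` N); split=> //; last first.
  by move=> x Ax; exact: AN.
by rewrite -[_ @^-1` _]setTI; exact: measurable_funP.
Qed.

Lemma bmeas_comp (f : T' -> R) : bmeas T' R f -> bmeas T R (f \o X).
Proof.
move=> /bmeasP[mf [M fM]]; apply/bmeasP; split; first exact: measurableT_comp.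
by exists M => x; exact: fM.
Qed.

Let r (f : T' -> R) := rho (f \o X).

Lemma risk_mapping_distribution :
  risk_mapping P rho -> risk_mapping (distribution P X) r.
Proof.
move=> [rho0 rhoD rho_le]; split=> [|Z c bZ|Z Z' bZ bZ' ZZ']; first exact: rho0.
- by apply: rhoD; exact: bmeas_comp.
- apply: rho_le; [exact: bmeas_comp|exact: bmeas_comp|].
  exact: ae_distribution ZZ'.
Qed.

Lemma risk_convex_distribution : risk_convex rho -> risk_convex r.
Proof.
by move=> cv l Z Z' l01 bZ bZ'; apply: cv => //; exact: bmeas_comp.
Qed.

Lemma risk_continuous_from_below_distribution :
  risk_continuous_from_below P rho ->
  risk_continuous_from_below (distribution P X) r.
Proof.
move=> rc Y_ Y bY_ bY incY cvY; apply: rc => [n||n w|].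
- exact: bmeas_comp.
- exact: bmeas_comp.
- exact: incY.
- exact: ae_distribution cvY.
Qed.

End risk_of_law.

(** * Coordinates of the path space, the dual representation at one state, and the equivalence *)

Lemma measurable_coord_at d (E : measurableType d) (t : nat) :
  measurable_fun setT (@coord_at d E t).
Proof.
move=> _ B mB; apply: sub_sigma_algebra; exists t => //.
by apply: sub_sigma_algebra; exists t => //=; exists B.
Qed.

HB.instance Definition _ d (E : measurableType d) t :=
  isMeasurableFun.Build _ _ (path_space E) E (@coord_at d E t)
    (@measurable_coord_at d E t).

Lemma measurable_transition d (E : measurableType d) (R : realType)
    (P : E -> probability (path_space E) R) (B : set E) :
  measurable_fun setT (P : E -> pprobability (path_space E) R) ->
  measurable B -> measurable_fun setT (fun x => transition P x B).
Proof.
move=> mP mB; have mXB : measurable (@coord_at _ E 1 @^-1` B).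
  by rewrite -[_ @^-1` _]setTI; exact: measurable_coord_at.
exact: (measurable_kernel (kprobability mP) _ mXB).
Qed.

Lemma one_step_representation d (E : measurableType d) (R : realType)
    (P : E -> probability (path_space E) R) (rho : E -> risk_sequence E R)
    (x : E) (f : E -> R) :
    measurable [set x] ->
    measurable_fun setT (P : E -> pprobability (path_space E) R) ->
    risk_mapping (P x) (risk0 (rho x)) -> risk_convex (risk0 (rho x)) ->
    risk_continuous_from_below (P x) (risk0 (rho x)) -> bmeas E R f ->
  (risk0 (rho x) (f \o coord_at 1))%:E
    = ereal_sup [set (\int[q x]_y (f y)%:E - penalty rho x (q x))%E
                | q in dominated_kernels P].
Proof.
move=> mx mP rr rcv rc bf; apply/eqP; rewrite eq_le; apply/andP; split; last first.
  apply: ge_ereal_sup => _ [q _ <-].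
  rewrite -EFin_Rintegral; last exact: bmeas_integrable.
  have : ((\int[q x]_y f y - one_step_risk rho x f)%:E <= penalty rho x (q x))%E.
    apply: ereal_sup_ubound; exists f => //.
    by rewrite -EFin_Rintegral//; exact: bmeas_integrable.
  case: (penalty rho x (q x)) => [p| |] //; last by rewrite addeNy leNye.
  by rewrite !lee_fin /one_step_risk; lra.
apply/lee_addgt0Pr => e e0; pose X1 : {mfun path_space E >-> E} := coord_at 1.
have [Q Qx rQ] := approximate_subgradient
  (risk_mapping_distribution X1 rr) (risk_convex_distribution X1 rcv)
  (risk_continuous_from_below_distribution (X := X1) rc) bf e0.
(* Off [x] the kernel is the transition kernel itself; it remains measurable because the singleton
   of [x] is. *)
pose q y : probability E R :=
  if pselect (y = x) then Q else distribution (P y) X1.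
have qx : q x = Q by rewrite /q; case: pselect.
have Kq : dominated_kernels P q.
  split=> [B mB|y].
    rewrite (_ : (fun y => q y B) =
        (fun y => if `[< y = x >] then Q B else transition P y B)); last first.
      by apply/funext => y; rewrite /q; case: pselect => yx;
        [rewrite asboolT|rewrite asboolF].
    apply: measurable_fun_ifT => //; last exact: measurable_transition.
    apply: (measurable_fun_bool true); rewrite setTI.
    rewrite (_ : _ @^-1` _ = [set x])//.
    by apply/seteqP; split => y /= /asboolP.
  by rewrite /q; case: pselect => [yx|_] //=; rewrite yx.
apply: (@le_trans _ _
  ((\int[q x]_y (f y)%:E - penalty rho x (q x)) + e%:E)%E); last first.
  by rewrite leeD2r//; apply: ereal_sup_ubound; exists q.
rewrite qx -EFin_Rintegral; last exact: bmeas_integrable.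
have : (penalty rho x Q <= (\int[Q]_y f y - one_step_risk rho x f + e)%:E)%E.
  apply: ge_ereal_sup => _ [g bg <-].
  rewrite -EFin_Rintegral; last exact: bmeas_integrable.
  by have := rQ _ bg; rewrite lee_fin /one_step_risk; lra.
(* The value [+oo] contradicts the bound just obtained; at [-oo] the right-hand side is [+oo]. *)
case: (penalty rho x Q) => [p| |] //; last by rewrite addey// addye// leey.
by rewrite !lee_fin /one_step_risk; lra.
Qed.

(** The ball of radius [dist y x] around any [y <> x] misses [x], so the complement is open. *)
Lemma polish_measurable_set1 (R : realType) (E : ptopologicalType) (x : E) :
  polish_space R E -> measurable ([set x] : set (borel E)).
Proof.
move=> [_ [dist [dist0 distC dist_tri dist_nbhs _]]].
rewrite -[X in measurable X]setCK; apply: measurableC.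
apply: sub_sigma_algebra; rewrite openE => y yx.
apply/dist_nbhs; exists (dist y x).
  rewrite lt_neqAle; apply/andP; split.
    by apply/eqP => /esym/dist0.
  have := dist_tri y x y; rewrite (distC x y) (dist0 y y).2//; lra.
by move=> z /= yz zx; move: yz; rewrite zx ltxx.
Qed.

Theorem proposition4p2 (R : realType) (E : ptopologicalType)
    (polishE : polish_space R E)
    (P : borel E -> probability (path_space (borel E)) R)
    (markovP : markov_chain P)
    (rho : borel E -> risk_sequence (borel E) R)
    (dynamic_rho : forall x : borel E, dynamic_risk_mapping (P x) (rho x))
    (regular_rho : regular_risk (fun x : borel E => risk0 (rho x)))
    (convex_rho : forall x : borel E, risk_convex (risk0 (rho x)))
    (cfb_rho : forall x : borel E,
       risk_continuous_from_below (P x) (risk0 (rho x))) :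
  one_step_markov rho P <->
  (forall (x : borel E) (f : borel E -> R), bmeas (borel E) R f ->
     (risk0 (rho x) (f \o coord_at 1))%:E
       = ereal_sup [set (\int[q x]_y (f y)%:E - penalty rho x (q x))%E
                   | q in dominated_kernels P]
     /\
     forall t : nat, (0 < t)%N ->
       {ae P x, forall w : path_space (borel E),
          (risk_at (rho x) t (f \o coord_at t.+1) w)%:E
            = ereal_sup [set (\int[q (coord_at t w)]_y (f y)%:E
                              - penalty rho (coord_at t w) (q (coord_at t w)))%E
                        | q in dominated_kernels P]}).
Proof.
have mE (x : borel E) : measurable [set x] by exact: polish_measurable_set1 polishE.
have [mP [P0 _]] := markovP.
(* Valid at every state, it can be applied at [X_t] along each path; for positive times both
   directions rewrite with it. *)
have rep (x : borel E) (f : borel E -> R) : bmeas (borel E) R f ->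
    (risk0 (rho x) (f \o coord_at 1))%:E
      = ereal_sup [set (\int[q x]_y (f y)%:E - penalty rho x (q x))%E
                  | q in dominated_kernels P].
  by apply: one_step_representation => //; have [] := dynamic_rho x.
split=> [markov x f bf|dual [|t] x f bf].
- split=> [|t _]; first exact: rep.
  by apply: filterS (markov t x f bf) => w ->; exact: rep.
(* At time 0 both sides agree wherever [X_0 = x], an event of probability 1. *)
- exists (~` (coord_at 0 @^-1` [set x])); split.
  + apply: measurableC; rewrite -[_ @^-1` _]setTI.
    exact: measurable_coord_at.
  + rewrite probability_setC ?P0 ?subee//.
    by rewrite -[_ @^-1` _]setTI; exact: measurable_coord_at.
  + by move=> w; apply: contra_not => /= ->.
- have [_ /(_ t.+1 isT)] := dual x f bf.
  apply: filterS => w; rewrite -rep// => eq_w.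
  exact: EFin_inj eq_w.
Qed.
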